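(* Let $\varepsilon\in(0,\varepsilon_0)$ be arbitrary and define $A_\varepsilon := z^+_\varepsilon - z^-_\varepsilon$, which satisfies $A_\varepsilon=\sqrt{12}\,\varepsilon^{-1}+\mathcal O(\varepsilon)$. Then the equation $$\partial_t u=\partial_x^2u+f_\varepsilon(u),\qquad (t,x)\in\mathbb R\times\mathbb R,$$ admits travelling wave solutions, i.e. solutions of the form $u(t,x)=\Phi_\varepsilon(x-s_\varepsilon t)$, with profile $\Phi_\varepsilon$ and speed $s_\varepsilon\in\mathbb R$ given by $$\Phi_\varepsilon(x)=A_\varepsilon\,\Phi^{\mathrm{hux}}(A_\varepsilon x)+z^-_\varepsilon,\qquad s_\varepsilon=\mathcal O(\varepsilon^2),$$ and satisfying $\lim_{x\to\pm\infty}\Phi_\varepsilon(x)=z^\pm_\varepsilon$. Here $\mathcal O(\cdot)$ refers to the limit $\varepsilon\downarrow0$.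
   Context: Fix $\alpha\in(0,1/2)$. For $\varepsilon\neq0$ let $$f_\varepsilon(u)=-u^3+(1+\alpha)u^2+(3\varepsilon^{-2}-\alpha)u-(1+\alpha)\varepsilon^{-2}.$$ (In the application $\varepsilon=C_{\delta,\sigma}^{-1/2}$, where $C_{\delta,\sigma}$ is the renormalization constant.) Let $\varepsilon_0>0$ and $z^-,z^0,z^+:\{\varepsilon\in\mathbb C:0<|\varepsilon|<\varepsilon_0\}\to\mathbb C$ be holomorphic functions $\varepsilon\mapsto z^\bullet_\varepsilon$ with $f_\varepsilon(z^-_\varepsilon)=f_\varepsilon(z^0_\varepsilon)=f_\varepsilon(z^+_\varepsilon)=0$, real-valued with $z^-_\varepsilon<z^0_\varepsilon<z^+_\varepsilon$ for $\varepsilon\in(0,\varepsilon_0)$, and with $z^0_\varepsilon=\frac{1+\alpha}{3}+\mathcal O(\varepsilon^2)$, $z^\pm_\varepsilon=\pm\sqrt3\,\varepsilon^{-1}+\frac{1+\alpha}{3}+\mathcal O(\varepsilon)$ as $\varepsilon\to0$ (such $\varepsilon_0$ and functions exist). Moreover $$\Phi^{\mathrm{hux}}(x)=\left(1+\exp(-x/\sqrt2)\right)^{-1}.$$ *)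

(* Defs.v *)
From Stdlib Require Import Reals.
From Coquelicot Require Import Coquelicot.
Open Scope R_scope.

(* f = O(g) along the filter F; [abs] is [Rabs] on R and [Cmod] on C.
   Coquelicot only provides the little-o counterpart [is_domin]. *)
Definition bigO {T : Type} (K : AbsRing) (F : (T -> Prop) -> Prop)
    (f g : T -> K) : Prop :=
  exists M : R, F (fun x => abs (f x) <= M * abs (g x)).

Definition punctured_disc (r : R) (z : C) : Prop := 0 < Cmod z < r.

(* Complex differentiability at each point of the set D, which is meant to be
   open; the values of g outside D are then irrelevant. *)
Definition holomorphic_on (D : C -> Prop) (g : C -> C) : Prop :=
  forall z : C, D z -> @ex_derive C_AbsRing C_NormedModule g z.

Definition f_eps_C (alpha : R) (eps u : C) : C :=
  (- u ^ 3 + (1 + alpha) * u ^ 2 + (3 / eps ^ 2 - alpha) * u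
   - (1 + alpha) / eps ^ 2)%C.

Definition f_eps (alpha eps u : R) : R :=
  - u ^ 3 + (1 + alpha) * u ^ 2 + (3 / eps ^ 2 - alpha) * u
  - (1 + alpha) / eps ^ 2.

Lemma f_eps_RtoC (alpha eps u : R) :
  eps <> 0 -> f_eps_C alpha (RtoC eps) (RtoC u) = RtoC (f_eps alpha eps u).
Proof.
intros Heps; unfold f_eps_C, f_eps.
assert (Heps2 : eps ^ 2 <> 0) by now apply pow_nonzero.
rewrite !RtoC_minus, !RtoC_plus, !RtoC_opp, !RtoC_mult.
rewrite !RtoC_div, RtoC_minus, !RtoC_div, !RtoC_plus, !RtoC_pow by exact Heps2.
reflexivity.
Qed.

Definition Phi_hux (x : R) : R := / (1 + exp (- x / sqrt 2)).

(* Values of z at positive real arguments, where z is assumed real-valued. *)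
Definition real_branch (z : C -> C) (eps : R) : R := Re (z (RtoC eps)).

Definition A_eps (zm zp : C -> C) (eps : R) : R :=
  real_branch zp eps - real_branch zm eps.

Definition Phi_eps (zm zp : C -> C) (eps x : R) : R :=
  A_eps zm zp eps * Phi_hux (A_eps zm zp eps * x) + real_branch zm eps.

(* The differentiability clauses are needed since [Derive] is total. *)
Definition reaction_diffusion_solution (F : R -> R) (u : R -> R -> R) : Prop :=
  forall t x : R,
    ex_derive (fun t' => u t' x) t /\
    ex_derive (u t) x /\
    ex_derive_n (u t) 2 x /\
    Derive (fun t' => u t' x) t = Derive_n (u t) 2 x + F (u t x).

Definition travelling_wave_solution (F : R -> R) (Phi : R -> R) (s : R) : Prop :=
  reaction_diffusion_solution F (fun t x => Phi (x - s * t)).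

(* Main.v *)
Require Import Defs.
From Stdlib Require Import Reals Lra.
From Coquelicot Require Import Coquelicot.
Open Scope R_scope.

(** A cubic [F u = - (u - a) * (u - b) * (u - c)] with three real roots has an
    explicit front joining [a] to [c].  The Huxley profile solves the logistic
    equation [h' = h * (1 - h) / sqrt 2], so its rescaling
    [P x = (c - a) * h ((c - a) * x) + a] solves the first-order equation
    [P' = (P - a) * (c - P) / sqrt 2].  Differentiating once more gives
    [P'' = (P - a) * (c - P) * (a + c - 2 * P) / 2], and since
    [F P = (P - a) * (c - P) * (P - b)], the sum [P'' + F P] is the common factor
    [(P - a) * (c - P)] times [(a + c) / 2 - b]: the dependence on [P] cancels.
    Hence [P'' + s * P' + F P = 0] for the constant speed
    [s = sqrt 2 * (b - (a + c) / 2)].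

    For the reaction term at hand the three branches are distinct real zeros, so
    it factors as above, and the coefficient of [u ^ 2] forces
    [a + b + c = 1 + alpha].  The speed thus becomes
    [3 / sqrt 2 * (b - (1 + alpha) / 3)], which the expansion of the middle root
    makes of order [eps ^ 2].  The expansion of [A_eps] is the difference of those
    of the two outer roots, in which the constants cancel and
    [2 * sqrt 3 = sqrt 12].  These expansions are assumed over complex [eps]; they
    pass to real ones because the real part of a complex number is bounded by its
    modulus. *)

(** * The Huxley profile *)

Lemma is_derive_Phi_hux (x : R) :
  is_derive Phi_hux x (Phi_hux x * (1 - Phi_hux x) / sqrt 2).
Proof.
assert (Hs : 0 < sqrt 2) by (apply sqrt_lt_R0; lra).
assert (He := exp_pos (- x / sqrt 2)).
unfold Phi_hux.
auto_derive; unfold Rdiv in *.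
- lra.
- field; lra.
Qed.

Lemma is_lim_Phi_hux_p : is_lim Phi_hux p_infty 1.
Proof.
assert (Hs : 0 < / sqrt 2)
  by (apply Rinv_0_lt_compat, sqrt_lt_R0; lra).
assert (He : is_lim (fun x => exp (- x / sqrt 2)) p_infty 0).
{ apply is_lim_comp with m_infty.
  - exact is_lim_exp_m.
  - replace m_infty with (Rbar_mult p_infty (- / sqrt 2)).
    + apply is_lim_ext with (fun x => x * (- / sqrt 2)).
      * intros x; unfold Rdiv; ring.
      * apply is_lim_scal_r, is_lim_id.
    + rewrite Rbar_mult_comm.
      apply is_Rbar_mult_unique, is_Rbar_mult_sym, is_Rbar_mult_p_infty_neg.
      simpl; lra.
  - exists 0; intros; discriminate. }
replace (Finite 1) with (Rbar_inv (1 + 0)) by (simpl; f_equal; field).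
apply is_lim_inv.
- exact (is_lim_plus' _ _ _ _ _ (is_lim_const 1 p_infty) He).
- intros H; injection H; lra.
Qed.

(** Reflecting the front exchanges its two ends, which reduces the limit on the
    left to the one on the right. *)
Lemma Phi_hux_opp (x : R) : Phi_hux (- x) = 1 - Phi_hux x.
Proof.
unfold Phi_hux.
replace (- - x / sqrt 2) with (- (- x / sqrt 2)) by (unfold Rdiv; ring).
rewrite exp_Ropp.
assert (He := exp_pos (- x / sqrt 2)).
field; lra.
Qed.

Lemma is_lim_Phi_hux_m : is_lim Phi_hux m_infty 0.
Proof.
apply is_lim_ext with (fun x => 1 - Phi_hux (- x)).
{ intros x; rewrite Phi_hux_opp; ring. }
replace (Finite 0) with (Finite (1 - 1)) by (f_equal; ring).
apply is_lim_minus'; [apply is_lim_const |].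
apply is_lim_comp with p_infty.
- exact is_lim_Phi_hux_p.
- exact (is_lim_opp _ _ _ (is_lim_id m_infty)).
- exists 0; intros; discriminate.
Qed.

(** * Fronts of a cubic reaction term *)

(** Passing to the moving frame [y = x - s * t] turns the equation into an
    ordinary one for the profile. *)
Lemma travelling_wave_of_profile (F P P' P'' : R -> R) (s : R) :
  (forall y, is_derive P y (P' y)) ->
  (forall y, is_derive P' y (P'' y)) ->
  (forall y, P'' y + s * P' y + F (P y) = 0) ->
  travelling_wave_solution F P s.
Proof.
intros H1 H2 Hode t x; cbv beta.
assert (Ht : is_derive (fun t' => P (x - s * t')) t (- s * P' (x - s * t))).
{ apply (is_derive_comp P (fun t' => x - s * t') t).
  - apply H1.
  - auto_derive; [exact I | ring]. }
assert (Hshift : forall (Q Q' : R -> R), (forall y, is_derive Q y (Q' y)) ->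
          forall x', is_derive (fun z => Q (z - s * t)) x' (Q' (x' - s * t))).
{ intros Q Q' HQ x'.
  replace (Q' (x' - s * t)) with (scal 1 (Q' (x' - s * t)))
    by apply (@scal_one R_AbsRing).
  apply (is_derive_comp Q (fun z => z - s * t) x').
  - apply HQ.
  - auto_derive; [exact I | ring]. }
assert (Hxx : is_derive (Derive (fun z => P (z - s * t))) x (P'' (x - s * t))).
{ apply is_derive_ext with (fun z => P' (z - s * t)).
  - intros z; symmetry; apply is_derive_unique, Hshift, H1.
  - apply Hshift, H2. }
repeat split.
- eexists; exact Ht.
- eexists; apply Hshift, H1.
- eexists; exact Hxx.
- change (Derive (fun t' => P (x - s * t')) t =
          Derive (Derive (fun z => P (z - s * t))) x + F (P (x - s * t))).
  apply is_derive_unique in Ht, Hxx.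
  rewrite Hxx; etransitivity; [exact Ht |].
  specialize (Hode (x - s * t)); lra.
Qed.

(** The profile obeys [P' = (P - a) * (c - P) / sqrt 2]; the speed is the value
    for which the factor left after extracting [(P - a) * (c - P)] vanishes. *)
Lemma cubic_travelling_wave (F : R -> R) (a b c : R) :
  (forall u, F u = - ((u - a) * (u - b) * (u - c))) ->
  travelling_wave_solution F
    (fun x => (c - a) * Phi_hux ((c - a) * x) + a)
    (sqrt 2 * (b - (a + c) / 2)).
Proof.
intros HF.
set (P := fun x => (c - a) * Phi_hux ((c - a) * x) + a).
assert (Hs : 0 < sqrt 2) by (apply sqrt_lt_R0; lra).
assert (Hss : sqrt 2 * sqrt 2 = 2) by (apply sqrt_sqrt; lra).
assert (HP : forall y, is_derive P y ((P y - a) * (c - P y) / sqrt 2)).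
{ intros y; unfold P.
  assert (Hh := is_derive_Phi_hux ((c - a) * y)).
  auto_derive.
  - eexists; exact Hh.
  - replace (Derive (fun x => Phi_hux x) ((c - a) * y))
      with (Phi_hux ((c - a) * y) * (1 - Phi_hux ((c - a) * y)) / sqrt 2)
      by (symmetry; apply is_derive_unique; exact Hh).
    field; lra. }
apply travelling_wave_of_profile with
  (P' := fun y => (P y - a) * (c - P y) / sqrt 2)
  (P'' := fun y => (P y - a) * (c - P y) * (a + c - 2 * P y) / 2).
- exact HP.
- intros y.
  assert (Hy := HP y).
  auto_derive.
  + assert (Hex : ex_derive P y) by (eexists; exact Hy).
    exact (conj Hex (conj Hex I)).
  + replace (Derive (fun x => P x) y) with ((P y - a) * (c - P y) / sqrt 2)
      by (symmetry; apply is_derive_unique; exact Hy).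
    (* With [2] written as a square, both sides are equal for any [sqrt 2 <> 0]. *)
    replace ((P y - a) * (c - P y) * (a + c - 2 * P y) / 2)
      with ((P y - a) * (c - P y) * (a + c - 2 * P y) / (sqrt 2 * sqrt 2))
      by now rewrite Hss.
    field; lra.
- intros y; rewrite HF; field; lra.
Qed.

Lemma is_lim_rescaled_Phi_hux (a c : R) :
  a < c ->
  is_lim (fun x => (c - a) * Phi_hux ((c - a) * x) + a) p_infty c /\
  is_lim (fun x => (c - a) * Phi_hux ((c - a) * x) + a) m_infty a.
Proof.
intros Hac.
assert (Hscal : forall l : Rbar, l = p_infty \/ l = m_infty ->
          is_lim (fun x => (c - a) * x) l l).
{ intros l Hl.
  replace l with (Rbar_mult (c - a) l) at 2.
  - apply is_lim_scal_l, is_lim_id.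
  - apply is_Rbar_mult_unique, is_Rbar_mult_sym.
    destruct Hl as [-> | ->].
    + apply is_Rbar_mult_p_infty_pos; simpl; lra.
    + apply is_Rbar_mult_m_infty_pos; simpl; lra. }
assert (Hgen : forall (l : Rbar) (v : R), l = p_infty \/ l = m_infty ->
          is_lim Phi_hux l v ->
          is_lim (fun x => (c - a) * Phi_hux ((c - a) * x) + a) l
            ((c - a) * v + a)).
{ intros l v Hl Hv.
  apply is_lim_plus'; [| apply is_lim_const].
  apply (is_lim_scal_l (fun x => Phi_hux ((c - a) * x)) (c - a) l v).
  apply is_lim_comp with l; [exact Hv | now apply Hscal |].
  destruct Hl as [-> | ->]; exists 0; intros; discriminate. }
split.
- assert (H := Hgen p_infty 1 (or_introl eq_refl) is_lim_Phi_hux_p).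
  replace ((c - a) * 1 + a) with c in H by ring; exact H.
- assert (H := Hgen m_infty 0 (or_intror eq_refl) is_lim_Phi_hux_m).
  replace ((c - a) * 0 + a) with a in H by ring; exact H.
Qed.

(** * Roots of the reaction term *)

(** The proof takes divided differences of the cubic at its roots: the first
    ones yield [p], their difference yields [S], and the value at [a] then
    yields [q]. *)
Lemma cubic_factorization (S p q a b c : R) :
  a < b < c ->
  - a ^ 3 + S * a ^ 2 + p * a - q = 0 ->
  - b ^ 3 + S * b ^ 2 + p * b - q = 0 ->
  - c ^ 3 + S * c ^ 2 + p * c - q = 0 ->
  S = a + b + c /\
  forall u, - u ^ 3 + S * u ^ 2 + p * u - q = - ((u - a) * (u - b) * (u - c)).
Proof.
intros Hord Ha Hb Hc.
assert (Hab : - (a ^ 2 + a * b + b ^ 2) + S * (a + b) + p = 0).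
{ apply Rmult_eq_reg_l with (b - a); lra. }
assert (Hac : - (a ^ 2 + a * c + c ^ 2) + S * (a + c) + p = 0).
{ apply Rmult_eq_reg_l with (c - a); lra. }
assert (HS : S = a + b + c).
{ apply Rmult_eq_reg_l with (c - b); lra. }
split; [exact HS | intros u].
assert (Hp : p = a ^ 2 + a * b + b ^ 2 - S * (a + b)) by lra.
assert (Hq : q = - a ^ 3 + S * a ^ 2 + p * a) by lra.
rewrite Hq, Hp, HS; ring.
Qed.

Lemma f_eps_real_branch (alpha eps : R) (z : C -> C) :
  eps <> 0 ->
  f_eps_C alpha (RtoC eps) (z (RtoC eps)) = RtoC 0 ->
  Im (z (RtoC eps)) = 0 ->
  f_eps alpha eps (real_branch z eps) = 0.
Proof.
intros Heps Hz Him.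
apply RtoC_inj; rewrite <- f_eps_RtoC by exact Heps.
replace (RtoC (real_branch z eps)) with (z (RtoC eps)); [exact Hz |].
apply injective_projections; [reflexivity | exact Him].
Qed.

(** * Restricting complex expansions to the positive real axis *)

Lemma locally'_RtoC_at_right (P : C -> Prop) :
  locally' (RtoC 0) P -> at_right 0 (fun eps => P (RtoC eps)).
Proof.
intros [d Hd]; exists d; intros eps Hball Hpos.
apply Hd.
- split; [exact Hball | apply ball_center].
- intros H; apply RtoC_inj in H; lra.
Qed.

(** The functions [fr] and [gr] need only represent [Re f] and [g] for positive
    arguments, so that [RtoC] may be moved across a division by [eps]. *)
Lemma bigO_at_right_Re (f g : C -> C) (fr gr : R -> R) :
  (forall eps, 0 < eps -> fr eps = Re (f (RtoC eps))) ->
  (forall eps, 0 < eps -> g (RtoC eps) = RtoC (gr eps)) ->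
  bigO C_AbsRing (locally' (RtoC 0)) f g ->
  bigO R_AbsRing (at_right 0) fr gr.
Proof.
intros Hf Hg [M HM]; exists M.
destruct (locally'_RtoC_at_right _ HM) as [d Hd]; exists d.
intros eps Hball Hpos.
specialize (Hd eps Hball Hpos).
change (Cmod (f (RtoC eps)) <= M * Cmod (g (RtoC eps))) in Hd.
change (Rabs (fr eps) <= M * Rabs (gr eps)).
rewrite Hg, Cmod_R in Hd by exact Hpos.
rewrite Hf by exact Hpos.
apply Rle_trans with (2 := Hd); apply re_le_Cmod.
Qed.

Lemma bigO_real_minus (F : (R -> Prop) -> Prop) {FF : Filter F}
    (f1 f2 g : R -> R) :
  bigO R_AbsRing F f1 g -> bigO R_AbsRing F f2 g ->
  bigO R_AbsRing F (fun x => f1 x - f2 x) g.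
Proof.
intros [M1 H1] [M2 H2]; exists (M1 + M2).
generalize (filter_and _ _ H1 H2); apply filter_imp; intros x [K1 K2].
change (Rabs (f1 x) <= M1 * Rabs (g x)) in K1.
change (Rabs (f2 x) <= M2 * Rabs (g x)) in K2.
change (Rabs (f1 x - f2 x) <= (M1 + M2) * Rabs (g x)).
assert (Ht := Rabs_triang (f1 x) (- f2 x)); rewrite Rabs_Ropp in Ht.
unfold Rminus; lra.
Qed.

Lemma bigO_real_scal (F : (R -> Prop) -> Prop) {FF : Filter F}
    (k : R) (f g : R -> R) :
  bigO R_AbsRing F f g -> bigO R_AbsRing F (fun x => k * f x) g.
Proof.
intros [M H]; exists (Rabs k * M).
generalize H; apply filter_imp; intros x K.
change (Rabs (f x) <= M * Rabs (g x)) in K.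
change (Rabs (k * f x) <= Rabs k * M * Rabs (g x)).
rewrite Rabs_mult, Rmult_assoc.
apply Rmult_le_compat_l; [apply Rabs_pos | exact K].
Qed.

(** * Travelling waves *)

Theorem theorem2p2 (alpha : R) (halpha : 0 < alpha < 1 / 2)
    (eps0 : R) (heps0 : 0 < eps0)
    (zm z0 zp : C -> C)
    (hzm_hol : holomorphic_on (punctured_disc eps0) zm)
    (hz0_hol : holomorphic_on (punctured_disc eps0) z0)
    (hzp_hol : holomorphic_on (punctured_disc eps0) zp)
    (hroots : forall eps : C, punctured_disc eps0 eps ->
       f_eps_C alpha eps (zm eps) = RtoC 0 /\
       f_eps_C alpha eps (z0 eps) = RtoC 0 /\
       f_eps_C alpha eps (zp eps) = RtoC 0)
    (hreal : forall eps : R, 0 < eps < eps0 ->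
       Im (zm (RtoC eps)) = 0 /\ Im (z0 (RtoC eps)) = 0 /\ Im (zp (RtoC eps)) = 0)
    (horder : forall eps : R, 0 < eps < eps0 ->
       real_branch zm eps < real_branch z0 eps < real_branch zp eps)
    (hz0_asym : bigO C_AbsRing (locally' (RtoC 0))
       (fun eps : C => (z0 eps - RtoC ((1 + alpha) / 3))%C)
       (fun eps : C => (eps ^ 2)%C))
    (hzp_asym : bigO C_AbsRing (locally' (RtoC 0))
       (fun eps : C =>
          (zp eps - (RtoC (sqrt 3) / eps + RtoC ((1 + alpha) / 3)))%C)
       (fun eps : C => eps))
    (hzm_asym : bigO C_AbsRing (locally' (RtoC 0))
       (fun eps : C =>
          (zm eps - (- (RtoC (sqrt 3) / eps) + RtoC ((1 + alpha) / 3)))%C)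
       (fun eps : C => eps)) :
  bigO R_AbsRing (at_right 0)
    (fun eps : R => A_eps zm zp eps - sqrt 12 / eps) (fun eps : R => eps) /\
  exists s : R -> R,
    bigO R_AbsRing (at_right 0) s (fun eps : R => eps ^ 2) /\
    forall eps : R, 0 < eps < eps0 ->
      travelling_wave_solution (f_eps alpha eps) (Phi_eps zm zp eps) (s eps) /\
      is_lim (Phi_eps zm zp eps) p_infty (real_branch zp eps) /\
      is_lim (Phi_eps zm zp eps) m_infty (real_branch zm eps).
Proof.
split.
- assert (Hp : bigO R_AbsRing (at_right 0)
      (fun eps => real_branch zp eps - (sqrt 3 / eps + (1 + alpha) / 3))
      (fun eps => eps)).
  { apply bigO_at_right_Re with (3 := hzp_asym); [| reflexivity].
    intros eps Hpos; rewrite <- RtoC_div by lra; reflexivity. }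
  assert (Hm : bigO R_AbsRing (at_right 0)
      (fun eps => real_branch zm eps - (- (sqrt 3 / eps) + (1 + alpha) / 3))
      (fun eps => eps)).
  { apply bigO_at_right_Re with (3 := hzm_asym); [| reflexivity].
    intros eps Hpos; rewrite <- RtoC_div by lra; reflexivity. }
  assert (H12 : sqrt 12 = 2 * sqrt 3).
  { replace 12 with (2 * 2 * 3) by ring.
    rewrite sqrt_mult, sqrt_square by lra; reflexivity. }
  destruct (bigO_real_minus _ _ _ _ Hp Hm) as [M HM]; exists M.
  generalize HM; apply filter_imp; intros eps H.
  replace (A_eps zm zp eps - sqrt 12 / eps)
    with (real_branch zp eps - (sqrt 3 / eps + (1 + alpha) / 3)
          - (real_branch zm eps - (- (sqrt 3 / eps) + (1 + alpha) / 3)));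
    [exact H |].
  unfold A_eps; rewrite H12; unfold Rdiv; ring.
- exists (fun eps => 3 / sqrt 2 * (real_branch z0 eps - (1 + alpha) / 3)).
  split.
  + apply bigO_real_scal; [apply within_filter, locally_filter |].
    apply bigO_at_right_Re with (3 := hz0_asym).
    * intros eps _; reflexivity.
    * intros eps _; rewrite <- RtoC_pow; reflexivity.
  + intros eps Heps.
    assert (Hne : eps <> 0) by lra.
    assert (Hdisc : punctured_disc eps0 (RtoC eps)).
    { unfold punctured_disc; rewrite Cmod_R, Rabs_pos_eq; lra. }
    destruct (hroots _ Hdisc) as (Hrm & Hr0 & Hrp).
    destruct (hreal _ Heps) as (Him & Hi0 & Hip).
    assert (Hord := horder _ Heps).
    destruct (cubic_factorization (1 + alpha) (3 / eps ^ 2 - alpha)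
                ((1 + alpha) / eps ^ 2) _ _ _ Hord
                (f_eps_real_branch alpha eps zm Hne Hrm Him)
                (f_eps_real_branch alpha eps z0 Hne Hr0 Hi0)
                (f_eps_real_branch alpha eps zp Hne Hrp Hip)) as [Hsum Hfact].
    split.
    * replace (3 / sqrt 2 * (real_branch z0 eps - (1 + alpha) / 3))
        with (sqrt 2 * (real_branch z0 eps
                        - (real_branch zm eps + real_branch zp eps) / 2)).
      { apply cubic_travelling_wave; exact Hfact. }
      assert (Hs : 0 < sqrt 2) by (apply sqrt_lt_R0; lra).
      assert (Hss : sqrt 2 * sqrt 2 = 2) by (apply sqrt_sqrt; lra).
      rewrite Hsum.
      apply Rmult_eq_reg_l with (sqrt 2); [| lra].
      rewrite <- Rmult_assoc, Hss; field; lra.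
    * apply is_lim_rescaled_Phi_hux; lra.
Qed.
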